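(* Let $K$ be a nonempty subset of a metric space $(X,d)$ and let $T, f, g: K \to K$ be self-maps satisfying $\overline{T(K)} \subseteq f(K) \cap g(K)$. Assume that for all $x,y \in K$, \[ d(Tx,Ty) \leq \psi\Big(\min\Big\{\max\big\{d(fx,gy),\, d(Tx,fx),\, d(Ty,gy),\, \tfrac{1}{2}[d(Tx,gy) + d(Ty,fx)]\big\},\ \max\big\{d(fy,gx),\, d(Tx,gx),\, d(Ty,fy),\, \tfrac{1}{2}[d(Tx,fy) + d(Ty,gx)]\big\}\Big\}\Big), \] where $\psi: \mathbb{R}_{+} \to \mathbb{R}_{+}$ is a monotonically increasing continuous function with $0 \leq \psi(t) < t$ for all $t > 0$. Suppose that at least one of the following holds: (i) $\overline{T(K)}$ is complete; (ii) $f(K)$ is complete; (iii) $g(K)$ is complete. Suppose also that the pairs $(T,f)$ and $(T,g)$ are weakly compatible. Then there exists a unique $z \in K$ such that \[ \{z\} = F(T) \cap F(f) \cap F(g). \]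
   Context: Notation: $\mathbb{R}_{+} = [0,\infty)$; $\overline{A}$ denotes the closure of a set $A$ in $X$; for a self-map $S$ of $K$, $F(S) = \{x \in K : Sx = x\}$ is its set of fixed points. Two self-maps $S, h$ of $K$ are called weakly compatible if they commute at their coincidence points: for every $x \in K$, if $hx = Sx$ then $hSx = Shx$. Completeness of a subset of $X$ means completeness with respect to the restricted metric $d$. *)

(* Defs.v *)
From HB Require Import structures.
From mathcomp Require Import all_boot all_order all_algebra.
From mathcomp Require Import all_classical all_reals all_analysis.

Set Implicit Arguments.
Unset Strict Implicit.
Unset Printing Implicit Defensive.

Import Order.TTheory GRing.Theory Num.Theory.

Local Open Scope classical_set_scope.
Local Open Scope ring_scope.

Definition fixed_points (T : Type) (K : set T) (S : T -> T) : set T :=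
  [set x | K x /\ S x = x].

Definition weakly_compatible (T : Type) (K : set T) (S h : T -> T) : Prop :=
  forall x, K x -> h x = S x -> h (S x) = S (h x).

(* Completeness of [A] for the restricted metric: the limit must lie in [A],
   and a sequence in [A] is Cauchy, or converges to a point of [A], in [A] if
   and only if it does so in [X]. *)
Definition complete_subset (R : realType) (X : metricType R) (A : set X) :
    Prop :=
  forall u : nat -> X, (forall n, A (u n)) -> cauchy (u @ \oo) ->
    exists2 l : X, A l & u @ \oo --> l.

(* Main.v *)
(** By monotonicity and continuity, [psi (e + 3 eta) + eta < e] for some
    [eta > 0], whenever [e > 0].  Build a Jungck sequence [y n = T (x n)] where
    [y n] is [f (x n.+1)] for odd [n] and [g (x n.+1)] for even [n].  Successive
    distances decrease to [0] by the gap, and the same gap, used at indices of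
    opposite parity (the only ones the contraction compares) in steps of two,
    makes [y] Cauchy.  Its limit [z] lies in the closure of [T(K)], hence
    [z = f u = g v]; the contraction forces [T u = z = T v], and weak
    compatibility turns these coincidences into [T z = f z = g z = z]. *)
Require Import Defs.
From HB Require Import structures.
From mathcomp Require Import all_boot all_order all_algebra.
From mathcomp Require Import all_classical all_reals all_analysis.
From mathcomp Require Import zify lra.

Set Implicit Arguments.
Unset Strict Implicit.
Unset Printing Implicit Defensive.

Import Order.TTheory GRing.Theory Num.Theory.
Import numFieldNormedType.Exports.

Local Open Scope classical_set_scope.
Local Open Scope ring_scope.

(** The factor 3 fits the Cauchy induction: a distance known up to [2 * eta], plus one more [eta]
    from each cross term, must still lie below the argument of [psi]. *)
Definition diagonal_gap (R : realType) (psi : R -> R) : Prop :=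
  forall e : R, 0 < e -> exists2 eta, 0 < eta & psi (e + 3 * eta) + eta < e.

(* The parameter [t] stands for any upper bound of the maximum in the
   contractive condition. *)
Definition pair_contraction (R : realType) (X : metricType R) (K : set X)
    (psi : R -> R) (T f g : X -> X) : Prop :=
  forall (x y : X) (t : R), K x -> K y ->
    mdist (f x) (g y) <= t -> mdist (T x) (f x) <= t ->
    mdist (T y) (g y) <= t ->
    mdist (T x) (g y) + mdist (T y) (f x) <= 2 * t ->
    mdist (T x) (T y) <= psi t.

(** This is [pair_contraction] at [x m.+1] and [x n.+1] along the Jungck sequence: one of the values
    under [f] and [g] is [y m], the other [y n], which forces opposite parities. *)
Definition parity_contraction (R : realType) (X : metricType R)
    (psi : R -> R) (y : nat -> X) : Prop :=
  forall (m n : nat) (t : R), odd m != odd n ->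
    mdist (y m) (y n) <= t -> mdist (y m.+1) (y m) <= t ->
    mdist (y n.+1) (y n) <= t ->
    mdist (y m.+1) (y n) + mdist (y n.+1) (y m) <= 2 * t ->
    mdist (y m.+1) (y n.+1) <= psi t.

Lemma continuous_diagonal_gap (R : realType) (psi : R -> R) :
  {within `[(0 : R), +oo[, continuous psi} ->
  (forall t : R, 0 < t -> psi t < t) -> diagonal_gap psi.
Proof.
move=> /continuous_within_itvcyP[psic _] psi_lt e e0.
have lt_e := psi_lt _ e0.
have mid : psi e < (psi e + e) / 2 by lra.
have /psic/cvgr_lt/(_ _ mid)/nbhs_ballP[d /= d0 ball_lt] : e \in `]0, +oo[%R.
  by rewrite in_itv /= andbT.
(* The first bound keeps [e + 3 * eta] in the ball of radius [d]; the second keeps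
   [(psi e + e) / 2 + eta] below [e]. *)
pose eta := Num.min (d / 4) ((e - psi e) / 4).
have eta0 : 0 < eta by rewrite lt_min; apply/andP; split; lra.
have [le1 le2] : eta <= d / 4 /\ eta <= (e - psi e) / 4.
  by split; rewrite ge_min lexx ?orbT.
exists eta => //.
have : psi (e + 3 * eta) < (psi e + e) / 2.
  by apply: ball_lt; rewrite /ball /= ltr_distlC; apply/andP; split; lra.
lra.
Qed.

(** If the later distance [e] were larger, it would bound every term at the indices [n.+1] and [n]:
    one cross distance vanishes and the other is at most [2 * e]. The gap then gives [e < e]. *)
Lemma parity_contraction_dist_noninc (R : realType) (X : metricType R)
    (psi : R -> R) (y : nat -> X) : diagonal_gap psi ->
  parity_contraction psi y ->
  forall n, mdist (y n.+2) (y n.+1) <= mdist (y n.+1) (y n).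
Proof.
move=> gap yc n; rewrite leNgt; apply/negP => lt_d.
have d0 := mdist_ge0 (y n.+1) (y n).
have [eta eta0 lt_e] := gap _ (le_lt_trans d0 lt_d).
have := metric_triangle (y n.+2) (y n.+1) (y n).
have := yc n.+1 n (mdist (y n.+2) (y n.+1) + 3 * eta).
rewrite mdistxx /= => H tri.
by have := H ltac:(by case: odd) ltac:(lra) ltac:(lra) ltac:(lra) ltac:(lra); lra.
Qed.

Lemma parity_contraction_dist_small (R : realType) (X : metricType R)
    (psi : R -> R) (y : nat -> X) : diagonal_gap psi ->
  parity_contraction psi y ->
  forall e, 0 < e ->
    exists N, forall n, (N <= n)%N -> mdist (y n.+1) (y n) <= e.
Proof.
move=> gap yc e e0.
have noninc := parity_contraction_dist_noninc gap yc.
pose D := range (fun n => mdist (y n.+1) (y n)).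
have infD : has_inf D.
  split; first by exists (mdist (y 1) (y 0)); exists 0%N.
  by exists 0 => _ [n _ <-]; exact: mdist_ge0.
have inf_le n : inf D <= mdist (y n.+1) (y n).
  by apply: (ge_inf infD.2); exists n.
suff inf0 : inf D <= 0.
  have [_ [N _ <-] ltN] := inf_adherent e0 infD.
  exists N; elim=> [|n IHn]; first by rewrite leqn0 => /eqP N0; subst N; lra.
  rewrite leq_eqVlt => /predU1P[<-|]; first by lra.
  by rewrite ltnS => /IHn; apply: le_trans.
(* If the infimum were positive, a distance within [eta] of it would be followed by one strictly
   below it. *)
rewrite leNgt; apply/negP => inf_gt0.
have [eta eta0 lt_e] := gap _ inf_gt0.
have [_ [N _ <-] ltN] := inf_adherent eta0 infD.
have := noninc N; have := inf_le N.+1.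
have := metric_triangle (y N.+2) (y N.+1) (y N).
have := yc N.+1 N (inf D + 3 * eta).
rewrite mdistxx /= => H tri leN noN.
by have := H ltac:(by case: odd) ltac:(lra) ltac:(lra) ltac:(lra) ltac:(lra); lra.
Qed.

Lemma parity_contraction_cauchy (R : realType) (X : metricType R)
    (psi : R -> R) (y : nat -> X) : diagonal_gap psi ->
  parity_contraction psi y -> cauchy (y @ \oo).
Proof.
move=> gap yc; apply: cauchy_exP => e e0.
have e40 : 0 < e / 4 by lra.
have [eta' eta'0 gape] := gap _ e40.
pose eta := Num.min eta' (e / 8).
have eta0 : 0 < eta by rewrite lt_min eta'0; lra.
have [le1 le2] : eta <= eta' /\ eta <= e / 8.
  by split; rewrite ge_min lexx ?orbT.
have [N small] := parity_contraction_dist_small gap yc eta0.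
(* Contracting the pair [N], [n.+1] brings [y N.+1] and [y n.+2] within [e / 4]; returning to [y N]
   and advancing to [y n.+3] costs [eta] each. The bound thus reproduces itself, and the index
   difference stays odd. *)
have odd_close k : mdist (y N) (y (N + k.*2.+1)%N) <= e / 4 + 2 * eta.
  elim: k => [|k IHk].
    by rewrite addn1 metric_sym; have := small _ (leqnn N); lra.
  rewrite doubleS !addnS; rewrite addnS in IHk.
  set n := (N + k.*2)%N in IHk *.
  have s0 := small _ (leqnn N).
  have s1 : mdist (y n.+2) (y n.+1) <= eta by apply: small; rewrite /n; lia.
  have s2 : mdist (y n.+3) (y n.+2) <= eta by apply: small; rewrite /n; lia.
  have t1 := metric_triangle (y N) (y N.+1) (y n.+3).
  have t2 := metric_triangle (y N.+1) (y n.+2) (y n.+3).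
  have t3 := metric_triangle (y N.+1) (y N) (y n.+1).
  have t4 := metric_triangle (y n.+2) (y n.+1) (y N).
  rewrite (metric_sym (y N) (y N.+1)) in t1.
  rewrite (metric_sym (y n.+2) (y n.+3)) in t2.
  rewrite (metric_sym (y n.+1) (y N)) in t4.
  have par : odd N != odd n.+1 by rewrite /n /= oddD odd_double addbF; case: odd.
  have := yc N n.+1 (e / 4 + 3 * eta') par
    ltac:(lra) ltac:(lra) ltac:(lra) ltac:(lra).
  lra.
(* An even positive difference is an odd one plus a last step, so the total is at most
   [e / 4 + 3 * eta], below [e] since [eta <= e / 8]. *)
exists (y N); exists N.+1 => // n /= Nn.
rewrite ballEmdist /=.
have [k [->|->]] : exists k, n = (N + k.*2.+1)%N \/ n = (N + k.*2.+2)%N.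
- by exists (n - N).-1./2; lia.
- by have := odd_close k; lra.
rewrite addnS.
have sk : mdist (y (N + k.*2.+1).+1) (y (N + k.*2.+1)%N) <= eta.
  by apply: small; lia.
have := metric_triangle (y N) (y (N + k.*2.+1)%N) (y (N + k.*2.+1).+1).
rewrite (metric_sym (y (N + k.*2.+1)%N)).
by have := odd_close k; lra.
Qed.

(** Compare [T u] with [T (x n.+1)] where [g (x n.+1) = T (x n)]: both sequence values are near [z],
    so every term is at most about [mdist (T u) z]. Infinitely many such [n] suffice, so the lemma
    also applies with [f] and [g] exchanged. *)
Lemma pair_contraction_coincidence (R : realType) (X : metricType R)
    (K : set X) (psi : R -> R) (T f g : X -> X) (x : nat -> X) (z u : X) :
  diagonal_gap psi -> pair_contraction K psi T f g ->
  (forall n, K (x n)) -> T (x n) @[n --> \oo] --> z ->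
  (forall N, exists2 n, (N <= n)%N & g (x n.+1) = T (x n)) ->
  K u -> f u = z -> T u = z.
Proof.
move=> gap Tfg Kx /metricType_numDomainType.cvgrPdist_lt xz freq Ku fuz.
apply/eqP/negPn; rewrite -mdist_gt0; apply/negP => d0.
have [eta eta0 lt_e] := gap _ d0.
have eta40 : 0 < eta / 4 by lra.
have [N _ near_z] := xz _ eta40.
have [n Nn gx] := freq N.
have z1 : mdist z (T (x n)) < eta / 4 by exact: near_z.
have z2 : mdist z (T (x n.+1)) < eta / 4 by apply: near_z; exact: leqW.
have := Tfg u (x n.+1) (mdist (T u) z + 3 * eta) Ku (Kx _).
rewrite gx fuz => H.
have t1 := metric_triangle (T (x n.+1)) z (T (x n)).
have t2 := metric_triangle (T u) z (T (x n)).
have t3 := metric_triangle (T u) (T (x n.+1)) z.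
rewrite (metric_sym (T (x n.+1)) z) in H t1 t3.
by have := H ltac:(lra) ltac:(lra) ltac:(lra) ltac:(lra); lra.
Qed.

(** At coincidence points each term is [0] or [mdist (T x) (T y)]. This gives both [T z = z] and the
    uniqueness of the common fixed point. *)
Lemma pair_contraction_value_unique (R : realType) (X : metricType R)
    (K : set X) (psi : R -> R) (T f g : X -> X) (x y : X) :
  diagonal_gap psi -> pair_contraction K psi T f g -> K x -> K y ->
  f x = T x -> g y = T y -> T x = T y.
Proof.
move=> gap Tfg Kx Ky fx gy.
apply/eqP/negPn; rewrite -mdist_gt0; apply/negP => d0.
have [eta eta0 lt_e] := gap _ d0.
have := Tfg x y (mdist (T x) (T y) + 3 * eta) Kx Ky.
rewrite fx gy !mdistxx (metric_sym (T y) (T x)) => H.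
by have := H ltac:(lra) ltac:(lra) ltac:(lra) ltac:(lra); lra.
Qed.

Lemma jungck_sequence (X : Type) (K : set X) (T f g : X -> X) :
  K !=set0 -> T @` K `<=` (f @` K) `&` (g @` K) ->
  exists x : nat -> X, [/\ forall n, K (x n),
    forall n, odd n -> f (x n.+1) = T (x n) &
    forall n, ~~ odd n -> g (x n.+1) = T (x n)].
Proof.
move=> [x0 Kx0] sub.
(* Membership in [K] is a premise inside the existential, so that the choice is total; outside [K]
   the value is a dummy. *)
have pick (b : bool) x : exists y,
    K x -> K y /\ (if b then f y else g y) = T x.
  have [Kx|nKx] := pselect (K x); last by exists x.
  have [[y Ky fy] [y' Ky' gy]] : ((f @` K) `&` (g @` K)) (T x).
    by apply: sub; exists x.
  by case: b; [exists y|exists y'].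
pose next n x := projT1 (cid (pick (odd n) x)).
pose fix x n := if n is m.+1 then next m (x m) else x0.
have nextP n : K (x n) ->
    K (x n.+1) /\ (if odd n then f (x n.+1) else g (x n.+1)) = T (x n).
  by rewrite /= /next; case: cid.
have Kx n : K (x n) by elim: n => // n /nextP[].
exists x; split=> // n on; have [_] := nextP n (Kx n).
  by rewrite on.
by rewrite (negbTE on).
Qed.

Lemma jungck_parity_contraction (R : realType) (X : metricType R) (K : set X)
    (psi : R -> R) (T f g : X -> X) (x : nat -> X) :
  pair_contraction K psi T f g -> (forall n, K (x n)) ->
  (forall n, odd n -> f (x n.+1) = T (x n)) ->
  (forall n, ~~ odd n -> g (x n.+1) = T (x n)) ->
  parity_contraction psi (fun n => T (x n)).
Proof.
move=> Tfg Kx fx gx m n t.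
case: (boolP (odd m)) => om; case: (boolP (odd n)) => on //= _.
  by have := Tfg (x m.+1) (x n.+1) t (Kx _) (Kx _); rewrite fx // gx.
(* Here [n] is the odd index, so its successor must take the [f] slot; symmetry of the distance
   restores the order. *)
have := Tfg (x n.+1) (x m.+1) t (Kx _) (Kx _); rewrite fx // gx //.
rewrite (metric_sym (T (x m))) (metric_sym (T (x m.+1)) (T (x n.+1))) addrC.
by move=> H ? ? ? ?; apply: H.
Qed.

Lemma pair_contraction_common_fixed_point (R : realType) (X : metricType R)
    (K : set X) (psi : R -> R) (T f g : X -> X) :
  set_fun K K f -> K !=set0 ->
  closure (T @` K) `<=` (f @` K) `&` (g @` K) ->
  diagonal_gap psi ->
  pair_contraction K psi T f g -> pair_contraction K psi T g f ->
  [\/ complete_subset (closure (T @` K)), complete_subset (f @` K)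
    | complete_subset (g @` K)] ->
  weakly_compatible K T f -> weakly_compatible K T g ->
  exists2 z, K z & [/\ T z = z, f z = z & g z = z].
Proof.
move=> fK K0 sub gap Tfg Tgf compl wf wg.
have [x [Kx fx gx]] := jungck_sequence K0 (subset_trans (@subset_closure _ _) sub).
have TKx n : closure (T @` K) (T (x n)).
  by apply: subset_closure; exists (x n).
have xC := parity_contraction_cauchy gap (jungck_parity_contraction Tfg Kx fx gx).
(* The sequence lies in all three sets, so any one completeness assumption gives a limit; closedness
   then puts it in both images. *)
have [z xz] : exists z : X, T (x n) @[n --> \oo] --> z.
  have fTK n : (f @` K) (T (x n)) by have [] := sub _ (TKx n).
  have gTK n : (g @` K) (T (x n)) by have [] := sub _ (TKx n).
  by case: compl => [/(_ _ TKx xC)|/(_ _ fTK xC)|/(_ _ gTK xC)] [z _ xz]; exists z.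
have : closure (T @` K) z.
  by apply: (closed_cvg _ (@closed_closure _ _) _ _ xz); exact: nearW.
move=> /sub[[u Ku fu] [v Kv gv]].
have Tu : T u = z.
  apply: (pair_contraction_coincidence gap Tfg Kx xz _ Ku fu) => N.
  by exists N.*2; [lia|apply: gx; rewrite odd_double].
have Tv : T v = z.
  apply: (pair_contraction_coincidence gap Tgf Kx xz _ Kv gv) => N.
  by exists N.*2.+1; [lia|apply: fx; rewrite /= odd_double].
have Kz : K z by rewrite -fu; exact: fK.
have fz : f z = T z by have := wf u Ku; rewrite fu Tu => ->.
have gz : g z = T z by have := wg v Kv; rewrite gv Tv => ->.
have Tz : T z = z.
  (* The coincidence point [z] of [T] and [f] is compared with the coincidence point [v] of [T] and
     [g]. *)
  rewrite -[RHS]Tv; apply: (pair_contraction_value_unique gap Tfg) => //.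
  by rewrite gv Tv.
by exists z => //; split=> //; rewrite ?fz ?gz.
Qed.

Theorem theorem3p1 (R : realType) (X : metricType R) (K : set X)
    (T f g : {fun K >-> K})
    (psi : {fun `[(0 : R), +oo[%classic >-> `[(0 : R), +oo[%classic}) :
  K !=set0 ->
  closure (T @` K) `<=` (f @` K) `&` (g @` K) ->
  (forall x y : X, K x -> K y ->
    mdist (T x) (T y) <=
    psi (Num.min
      (Num.max (mdist (f x) (g y))
        (Num.max (mdist (T x) (f x))
          (Num.max (mdist (T y) (g y))
            (2^-1 * (mdist (T x) (g y) + mdist (T y) (f x))))))
      (Num.max (mdist (f y) (g x))
        (Num.max (mdist (T x) (g x))
          (Num.max (mdist (T y) (f y))
            (2^-1 * (mdist (T x) (f y) + mdist (T y) (g x)))))))) ->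
  {in `[(0 : R), +oo[ &, {homo psi : s t / s <= t}} ->
  {within `[(0 : R), +oo[%classic, continuous psi} ->
  (forall t : R, 0 < t -> 0 <= psi t < t) ->
  [\/ complete_subset (closure (T @` K)), complete_subset (f @` K)
    | complete_subset (g @` K)] ->
  weakly_compatible K T f ->
  weakly_compatible K T g ->
  exists! z : X, K z /\
    [set z] = fixed_points K T `&` fixed_points K f `&` fixed_points K g.
Proof.
move=> K0 sub contr psi_mono psi_cont psi_lt compl wf wg.
have gap : diagonal_gap psi.
  by apply: continuous_diagonal_gap => // t /psi_lt/andP[].
have mono (s t : R) : 0 <= s -> s <= t -> psi s <= psi t.
  move=> s0 st; apply: psi_mono => //; rewrite in_itv /= andbT //.
  exact: le_trans st.
(* A bound on either maximum bounds the minimum, and [psi] is monotone: the first maximum gives the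
   order [f], [g], the second the order [g], [f]. *)
have [Tfg Tgf] : pair_contraction K psi T f g /\ pair_contraction K psi T g f.
  split=> x y t Kx Ky h1 h2 h3 h4; apply: (le_trans (contr x y Kx Ky));
    apply: mono.
  - by rewrite le_min !le_max !mdist_ge0.
  - rewrite ge_min !ge_max h1 h2 h3 /=.
    by apply/orP; left; lra.
  - by rewrite le_min !le_max !mdist_ge0.
  rewrite ge_min !ge_max (metric_sym (f y)) h1 h2 h3 /=.
  by apply/orP; right; lra.
have [z Kz [Tz fz gz]] := pair_contraction_common_fixed_point
  (@funS _ _ _ _ f) K0 sub gap Tfg Tgf compl wf wg.
have zE : [set z] = fixed_points K T `&` fixed_points K f `&` fixed_points K g.
  apply/seteqP; split=> [_ ->|w [[[Kw Tw] [_ fw]] [_ gw]]] //=.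
  rewrite -Tw -[RHS]Tz.
  by apply: (pair_contraction_value_unique gap Tfg) => //; rewrite ?fw ?gz.
exists z; split=> // w [_]; rewrite -zE => wz.
by have : [set w] w by []; rewrite wz.
Qed.
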